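(* Let $(X,\mathcal{U})$ be a $T_0$ bicomplete quasi-uniform space generated by a family $\mathcal{D}=\{d_\alpha\}_{\alpha\in A}$ of quasi-pseudometrics, and let $T\colon X\to 2^X$ be a multivalued map that has a selector which is a $\mathcal{D}$-contraction. Then $T$ admits a $\mathcal{U}$-startpoint (and a $\mathcal{U}$-endpoint).
   Context: $X$ is a non-empty set. A quasi-uniformity on $X$ is a filter $\mathcal{U}$ on $X\times X$ such that every $U\in\mathcal{U}$ contains the diagonal $\Delta_X$ and for every $U\in\mathcal{U}$ there is $V\in\mathcal{U}$ with $V\circ V\subseteq U$, where $V\circ V=\{(x,z):\exists y,\ (x,y)\in V,\ (y,z)\in V\}$. The pair $(X,\mathcal{U})$ is a quasi-uniform space. Put $U^{-1}=\{(x,y):(y,x)\in U\}$. The symmetrisation $\mathcal{U}^s$ is the uniformity generated by the entourages $U\cap U^{-1}$, $U\in\mathcal{U}$. $\mathcal{U}$ is $T_0$ if the preorder $\bigcap\mathcal{U}:=\bigcap_{U\in\mathcal{U}}U$ is antisymmetric. $(X,\mathcal{U})$ is bicomplete if the uniform space $(X,\mathcal{U}^s)$ is complete (every net that is Cauchy for $\mathcal{U}^s$ converges in $\mathcal{U}^s$). A quasi-pseudometric on $X$ is a function $d\colon X\times X\to[0,\infty)$ with $d(x,x)=0$ and $d(x,z)\le d(x,y)+d(y,z)$. A family $\mathcal{D}$ of quasi-pseudometrics generates the quasi-uniformity having as subbase the sets $\{(x,y):d(x,y)<\varepsilon\}$, $d\in\mathcal{D}$, $\varepsilon>0$. A self-map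 $f\colon X\to X$ is a $\mathcal{D}$-contraction if there is a family $\{k_\alpha\}_{\alpha\in A}\subseteq[0,1)$ such that for every $\alpha\in A$ and all $x,y\in X$, $d_\alpha(f(x),f(y))\le k_\alpha d_\alpha(x,y)$ and $d_\alpha(f(y),f(x))\le k_\alpha d_\alpha(y,x)$. A selector of $T\colon X\to 2^X$ is a map $f\colon X\to X$ with $f(x)\in Tx$ for every $x\in X$. A point $x_0$ is a $\mathcal{U}$-startpoint of $T\colon X\to 2^X$ if there is $z\in Tx_0$ with $(x_0,z)\in\bigcap\mathcal{U}$, and a $\mathcal{U}$-endpoint of $T$ if there is $z\in Tx_0$ with $(z,x_0)\in\bigcap\mathcal{U}$. *)

(* Defs.v *)
From mathcomp Require Import all_boot all_order all_algebra.
From mathcomp Require Import boolp classical_sets filter reals.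

Set Implicit Arguments.
Unset Strict Implicit.
Unset Printing Implicit Defensive.

Import Order.TTheory GRing.Theory Num.Theory.

Local Open Scope ring_scope.
Local Open Scope classical_set_scope.
Local Open Scope relation_scope.

Record is_quasi_uniformity (X : Type) (U : set_system (X * X)) : Prop := {
  quasi_uniformity_filter : Filter U;
  quasi_uniformity_diagonal : forall V, U V -> diagonal `<=` V;
  quasi_uniformity_split :
    forall V, U V -> exists2 W, U W & W \; W `<=` V
}.

(* The filter having the set system [B] as a subbase. *)
Definition generated_filter (T : Type) (B : set_system T) : set_system T :=
  smallest (@Filter T) B.

Definition symmetrisation (X : Type) (U : set_system (X * X)) :
    set_system (X * X) :=
  generated_filter [set V `&` V^-1 | V in U].

Definition ent_preorder (X : Type) (U : set_system (X * X)) : set (X * X) :=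
  \bigcap_(V in U) V.

Definition T0_quasi_uniformity (X : Type) (U : set_system (X * X)) : Prop :=
  forall x y : X, ent_preorder U (x, y) -> ent_preorder U (y, x) -> x = y.

Record is_directed (I : Type) (le : I -> I -> Prop) : Prop := {
  directed_nonempty : inhabited I;
  directed_refl : forall i, le i i;
  directed_trans : forall i j k, le i j -> le j k -> le i k;
  directed_ub : forall i j, exists2 k, le i k & le j k
}.

Definition cauchy_net (X : Type) (W : set_system (X * X))
    (I : Type) (le : I -> I -> Prop) (s : I -> X) : Prop :=
  forall V, W V ->
    exists i0, forall i j, le i0 i -> le i0 j -> V (s i, s j).

Definition net_converges (X : Type) (W : set_system (X * X))
    (I : Type) (le : I -> I -> Prop) (s : I -> X) (l : X) : Prop :=
  forall V, W V -> exists i0, forall i, le i0 i -> V (l, s i).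

Definition complete_uniformity (X : Type) (W : set_system (X * X)) : Prop :=
  forall (I : Type) (le : I -> I -> Prop), is_directed le ->
  forall s : I -> X, cauchy_net W le s -> exists l, net_converges W le s l.

Definition bicomplete (X : Type) (U : set_system (X * X)) : Prop :=
  complete_uniformity (symmetrisation U).

Record is_quasi_pseudometric (R : realType) (X : Type) (d : X -> X -> R) :
    Prop := {
  qpm_ge0 : forall x y, 0 <= d x y;
  qpm_refl : forall x, d x x = 0;
  qpm_triangle : forall x y z, d x z <= d x y + d y z
}.

Definition generated_by (R : realType) (X A : Type) (d : A -> X -> X -> R) :
    set_system (X * X) :=
  generated_filter [set V | exists a : A, exists2 e : R,
    0 < e & V = [set p | d a p.1 p.2 < e]].

Definition family_contraction (R : realType) (X A : Type)
    (d : A -> X -> X -> R) (f : X -> X) : Prop :=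
  exists k : A -> R, (forall a, 0 <= k a < 1) /\
    forall a x y, d a (f x) (f y) <= k a * d a x y /\
                  d a (f y) (f x) <= k a * d a y x.

Definition is_selector (X : Type) (T : X -> set X) (f : X -> X) : Prop :=
  forall x, T x (f x).

Definition startpoint (X : Type) (U : set_system (X * X)) (T : X -> set X)
    (x0 : X) : Prop :=
  exists2 z, T x0 z & ent_preorder U (x0, z).

Definition endpoint (X : Type) (U : set_system (X * X)) (T : X -> set X)
    (x0 : X) : Prop :=
  exists2 z, T x0 z & ent_preorder U (z, x0).

(* Main.v *)
Require Import Defs.
From mathcomp Require Import all_boot all_order all_algebra.
From mathcomp Require Import boolp classical_sets filter reals.
From mathcomp Require Import topology normedtype sequences lra.

(** The orbit of any point under a contracting selector [f] is Cauchy for every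
    [d a] in both directions: orbits are bounded, and [n] iterations shrink
    distances by [k a ^+ n].  By bicompleteness the orbit converges to some [l]
    for both [d a] and its conjugate, so [d a l (f l) = d a (f l) l = 0] for
    all [a], and [T0] gives [f l = l].  A fixed point of a selector of [T] is
    both a startpoint and an endpoint of [T]. *)

Set Implicit Arguments.
Unset Strict Implicit.
Unset Printing Implicit Defensive.

Import Order.TTheory GRing.Theory Num.Theory.
Import numFieldNormedType.Exports.

Local Open Scope ring_scope.
Local Open Scope classical_set_scope.
Local Open Scope relation_scope.

Lemma generated_by_ball (R : realType) (X A : Type) (d : A -> X -> X -> R)
    (a : A) (e : R) :
  0 < e -> generated_by d [set p | d a p.1 p.2 < e].
Proof. by move=> e_gt0 F [_]; apply; exists a, e. Qed.

Lemma symmetrisation_ball (R : realType) (X A : Type) (d : A -> X -> X -> R)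
    (a : A) (e : R) :
  0 < e -> symmetrisation (generated_by d)
    [set p | d a p.1 p.2 < e /\ d a p.2 p.1 < e].
Proof.
move=> e_gt0 F [_]; apply.
by exists [set p | d a p.1 p.2 < e] => //; exact: generated_by_ball.
Qed.

Lemma ent_preorder_generated_by (R : realType) (X A : Type)
    (d : A -> X -> X -> R) (x y : X) :
  (forall a, d a x y = 0) -> ent_preorder (generated_by d) (x, y).
Proof.
(* The sets containing [(x, y)] form a filter, so by minimality of the generated filter only the
   subbasic balls need checking. *)
move=> d0 V UV; apply: (UV (fun W => W (x, y))); split.
  by split=> [|P Q Px Qx|P Q PQ Px]; [|split|exact: PQ].
by move=> _ [a [e e_gt0 ->]] /=; rewrite d0.
Qed.

(** The sets [F] that contain all late pairs of [s] form a filter. Minimality is used twice: for the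
    symmetrisation, then for the quasi-uniformity itself. Late pairs are ordered, so swapping [i]
    and [j] handles the inverse entourages. *)
Lemma cauchy_net_symmetrisation (R : realType) (X A : Type)
    (d : A -> X -> X -> R) (I : Type) (le : I -> I -> Prop) (s : I -> X) :
  is_directed le ->
  (forall a e, 0 < e -> exists i0, forall i j, le i0 i -> le i0 j ->
     d a (s i) (s j) < e) ->
  cauchy_net (symmetrisation (generated_by d)) le s.
Proof.
move=> le_dir s_cauchy.
pose F : set_system (X * X) := fun V =>
  exists i0, forall i j, le i0 i -> le i0 j -> V (s i, s j).
have F_filter : Filter F.
  split=> [|P Q [i0 P_i0] [j0 Q_j0]|P Q PQ [i0 P_i0]].
  - by have [[i0] _ _ _] := le_dir; exists i0.
  - have [_ _ le_tr /(_ i0 j0)[k0 ik jk]] := le_dir.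
    by exists k0 => i j ki kj; split; [apply: P_i0|apply: Q_j0]; apply: le_tr;
      eauto.
  - by exists i0 => i j ? ?; apply/PQ/P_i0.
move=> V /(_ F); apply; split=> // _ [W UW <-].
have [i0 W_i0] : F W.
  by apply: UW; split=> // _ [a [e e_gt0 ->]]; exact: s_cauchy.
by exists i0 => i j ? ?; split; apply: W_i0.
Qed.

Section contraction_orbit.
Context (R : realType) (X : Type) (d : X -> X -> R) (f : X -> X) (k : R).
Hypotheses (d_qpm : is_quasi_pseudometric d) (k_bounds : 0 <= k < 1).
Hypothesis f_contr : forall x y, d (f x) (f y) <= k * d x y.

Lemma contraction_iter (n : nat) (x y : X) :
  d (iter n f x) (iter n f y) <= k ^+ n * d x y.
Proof.
have /andP[k_ge0 _] := k_bounds.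
elim: n => [|n IHn]; first by rewrite mul1r.
by rewrite exprS -mulrA; apply: le_trans (f_contr _ _) (ler_wpM2l k_ge0 IHn).
Qed.

(** The bound is the fixed point of [t |-> d x (f x) + k * t]. The triangle inequality through [f x]
    shows that this map bounds each distance in terms of the previous one. *)
Lemma orbit_bounded_from (x : X) (n : nat) :
  d x (iter n f x) <= d x (f x) / (1 - k).
Proof.
have /andP[k_ge0 k_lt1] := k_bounds.
rewrite ler_pdivlMr ?subr_gt0//.
elim: n => [|n IHn]; first by rewrite (qpm_refl d_qpm) mul0r (qpm_ge0 d_qpm).
have := qpm_triangle d_qpm x (f x) (iter n.+1 f x).
have := f_contr x (iter n f x).
by rewrite /=; nra.
Qed.

Lemma orbit_bounded_to (x : X) (n : nat) :
  d (iter n f x) x <= d (f x) x / (1 - k).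
Proof.
have /andP[k_ge0 k_lt1] := k_bounds.
rewrite ler_pdivlMr ?subr_gt0//.
elim: n => [|n IHn]; first by rewrite (qpm_refl d_qpm) mul0r (qpm_ge0 d_qpm).
have := qpm_triangle d_qpm (iter n.+1 f x) (f x) x.
have := f_contr (iter n f x) x.
by rewrite /=; nra.
Qed.

Lemma orbit_cauchy (x : X) (e : R) : 0 < e ->
  exists n, forall i j, (n <= i)%N -> (n <= j)%N ->
    d (iter i f x) (iter j f x) < e.
Proof.
move=> e_gt0; have /andP[k_ge0 k_lt1] := k_bounds.
(* [C] bounds the distance between any two orbit points, by passing through [x]. *)
pose C := d (f x) x / (1 - k) + d x (f x) / (1 - k).
have C_bound i j : d (iter i f x) (iter j f x) <= C.
  apply: le_trans (qpm_triangle d_qpm _ x _) _.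
  exact: lerD (orbit_bounded_to _ _) (orbit_bounded_from _ _).
have [n kCn] : exists n, k ^+ n * C < e.
  have kC0 : (fun n => k ^+ n * C) @ \oo --> (0 : R).
    rewrite -(mul0r C); apply: cvgM (cvg_cst C); apply: cvg_expr.
    by rewrite ger0_norm.
  have [n _ /(_ n (leqnn n))] := cvgr_lt _ kC0 _ e_gt0.
  by exists n.
(* Both points are [n]-fold images of orbit points, which lie within [C] of each other. *)
exists n => i j ni nj; rewrite -(subnKC ni) -(subnKC nj) !iterD.
apply: le_lt_trans (contraction_iter _ _ _) (le_lt_trans _ kCn).
by rewrite ler_wpM2l ?exprn_ge0.
Qed.

(** With [x_n] the orbit, [d l (f l) <= d l x_(n+1) + k * d x_n l], and symmetrically for
    [d (f l) l]. Each bound mixes the two directions of convergence, and each of its terms is below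
    [e / 2] for large [n]. *)
Lemma orbit_limit_fixed (x l : X) :
  (forall e : R, 0 < e -> exists n, forall i, (n <= i)%N ->
     d l (iter i f x) < e /\ d (iter i f x) l < e) ->
  d l (f l) = 0 /\ d (f l) l = 0.
Proof.
move=> l_lim; have /andP[k_ge0 k_lt1] := k_bounds.
by split; apply/eqP; rewrite eq_le (qpm_ge0 d_qpm) andbT;
  apply/ler_addgt0Pr => e e_gt0;
  have [n near_l] := l_lim (e / 2) (divr_gt0 e_gt0 (ltr0Sn R 1));
  have [near1 near2] := near_l n (leqnn n);
  have [near3 near4] := near_l n.+1 (leqnSn n);
  [have := qpm_triangle d_qpm l (iter n.+1 f x) (f l);
   have := f_contr (iter n f x) l
  |have := qpm_triangle d_qpm (f l) (iter n.+1 f x) l;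
   have := f_contr l (iter n f x)];
  have := qpm_ge0 d_qpm l (iter n f x);
  have := qpm_ge0 d_qpm (iter n f x) l;
  move: near1 near2 near3 near4; rewrite /=; nra.
Qed.

End contraction_orbit.

Lemma leq_directed : is_directed (fun m n : nat => (m <= n)%N).
Proof.
split=> [||i j k|i j]; [exact: inhabits 0%N|exact: leqnn|exact: leq_trans|].
by exists (maxn i j); rewrite (leq_maxl, leq_maxr).
Qed.

Lemma family_contraction_fixed_point (R : realType) (X A : Type)
    (d : A -> X -> X -> R) (f : X -> X) :
  inhabited X -> (forall a, is_quasi_pseudometric (d a)) ->
  T0_quasi_uniformity (generated_by d) -> bicomplete (generated_by d) ->
  family_contraction d f -> exists x, f x = x.
Proof.
move=> [x0] d_qpm U_T0 U_bicomplete [k [k_bounds k_contr]].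
have f_contr a x y : d a (f x) (f y) <= k a * d a x y.
  by have [] := k_contr a x y.
have [l l_lim] : exists l, net_converges (symmetrisation (generated_by d))
    (fun m n : nat => (m <= n)%N) (fun n => iter n f x0) l.
  apply: U_bicomplete leq_directed _ (cauchy_net_symmetrisation leq_directed _).
  move=> a e; exact: orbit_cauchy (d_qpm a) (k_bounds a) (f_contr a) x0 e.
have fixed a : d a l (f l) = 0 /\ d a (f l) l = 0.
  apply: (orbit_limit_fixed (d_qpm a) (k_bounds a) (f_contr a) (x := x0)).
  by move=> e e_gt0; exact: l_lim (symmetrisation_ball a e_gt0).
exists l.
(* Vanishing distances put [l] and [f l] below each other in the preorder. *)
by apply: U_T0; apply: ent_preorder_generated_by => a; have [] := fixed a.
Qed.

Theorem corollary6p6 (R : realType) (X : Type) (X_nonempty : inhabited X)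
    (U : set_system (X * X)) (U_quasi_uniformity : is_quasi_uniformity U)
    (U_T0 : T0_quasi_uniformity U) (U_bicomplete : bicomplete U)
    (A : Type) (d : A -> X -> X -> R)
    (d_quasi_pseudometric : forall a, is_quasi_pseudometric (d a))
    (U_generated : U = generated_by d)
    (T : X -> set X)
    (T_selector : exists2 f : X -> X,
       is_selector T f & family_contraction d f) :
  (exists x, startpoint U T x) /\ (exists x, endpoint U T x).
Proof.
have [f f_sel f_contr] := T_selector.
rewrite U_generated in U_quasi_uniformity U_T0 U_bicomplete *.
have [x fx] := family_contraction_fixed_point
  X_nonempty d_quasi_pseudometric U_T0 U_bicomplete f_contr.
(* Since [x = f x] lies in [T x], the point [x] itself serves as the witness [z] for both claims. *)
have Tx : T x x by rewrite -[X in T _ X]fx; exact: f_sel.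
have xx : ent_preorder (generated_by d) (x, x).
  by move=> V /(quasi_uniformity_diagonal U_quasi_uniformity); apply.
by split; exists x; exists x.
Qed.
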